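(* Algorithm $\mathcal{D}^2\mathcal{I}$ is optimal: every $2$-sortable permutation, given as input to the $\mathfrak{D}^2\mathfrak{I}$ machine operated by algorithm $\mathcal{D}^2\mathcal{I}$, is output in increasing order.
   Context: The $\mathfrak{D}^2\mathfrak{I}$ machine consists of two decreasing stacks $D_1,D_2$ followed in series by an increasing stack $I$. Elements of $D_1,D_2$ must be in decreasing order from top to bottom (top largest); elements of $I$ in increasing order from top to bottom (top smallest). Operations: $d_0$ pushes the next input element (called $Input$) into $D_1$; $d_1$ moves $Top(D_1)$ to $D_2$; $d_2$ moves $Top(D_2)$ to $I$; $d_3$ pops $Top(I)$ and appends it to the output. An operation is legal if it respects the stack restrictions. A permutation is $2$-sortable if some sequence of legal operations outputs its elements in increasing order. Any comparison involving an empty stack is considered true. Conditions: ($\alpha$) $Top(D_2)<Top(I)$; ($\beta$) $Top(D_2)<Top(D_1)$ and $Top(D_1)<Top(I)$; ($\gamma$) $Top(D_1)<Input$, $Input<Top(I)$, and the sequence of input elements from $Input$ up to the first input element larger than $Top(D_2)$ is increasing. Algorithm $\mathcal{D}^2\mathcal{I}$ repeatedly executes the first applicable instruction among: 1. if $Top(I)$ is the next element to be output (the smallest element not yet output), perform $d_3$; 2. if the elements contained in $D_1\cup D_2$ are exactly the next elements to be output, move them to the output in increasing order; 3. perform $d_1$ if it is legal and ($\beta$) holds; 4. perform $d_0$ if it is legal and ($\gamma$) holds; 5. perform $d_2$ if it is legal and ($\alpha$) holds; 6. otherwise perform $d_3$. *)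

(* Defs.v *)
From mathcomp Require Import all_boot.
Set Implicit Arguments. Unset Strict Implicit. Unset Printing Implicit Defensive.

(* Machine state: stacks are sequences whose head is the top. *)
Record state := State {
  inp : seq nat;   (* remaining input, head = Input *)
  D1 : seq nat;
  D2 : seq nat;
  I : seq nat;
  out : seq nat    (* output so far, in order of emission *)
}.

Definition init (p : seq nat) : state := State p [::] [::] [::] [::].

Definition final (s : state) : bool :=
  [&& nilp (inp s), nilp (D1 s), nilp (D2 s) & nilp (I s)].

(* "Any comparison involving an empty stack (or empty input) is true." *)
Definition olt (a b : option nat) : bool :=
  match a, b with Some x, Some y => x < y | _, _ => true end.

Definition top (s : seq nat) : option nat := ohead s.

Inductive op := d0 | d1 | d2 | d3.

Definition exec_op (o : op) (s : state) : option state :=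
  let: State i a b c w := s in
  match o with
  | d0 => if i is x :: i' then
            if olt (top a) (Some x) then Some (State i' (x :: a) b c w) else None
          else None
  | d1 => if a is x :: a' then
            if olt (top b) (Some x) then Some (State i a' (x :: b) c w) else None
          else None
  | d2 => if b is x :: b' then
            if olt (Some x) (top c) then Some (State i a b' (x :: c) w) else None
          else None
  | d3 => if c is x :: c' then Some (State i a b c' (rcons w x)) else None
  end.

Fixpoint exec_ops (os : seq op) (s : state) : option state :=
  if os is o :: os' then
    if exec_op o s is Some s' then exec_ops os' s' else None
  else Some s.

Definition two_sortable (p : seq nat) : Prop :=
  exists os s, exec_ops os (init p) = Some s /\ final s /\ sorted ltn (out s).

Definition remaining (s : state) : seq nat := inp s ++ D1 s ++ D2 s ++ I s.

Definition next_out (s : state) : option nat := ohead (sort leq (remaining s)).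

Definition cond_alpha (s : state) : bool := olt (top (D2 s)) (top (I s)).

Definition cond_beta (s : state) : bool :=
  olt (top (D2 s)) (top (D1 s)) && olt (top (D1 s)) (top (I s)).

(* input elements from Input up to (and including) the first input element
   larger than Top(D2) (the whole remaining input if there is none) *)
Definition gamma_seg (s : state) : seq nat :=
  take (find (fun x => olt (top (D2 s)) (Some x)) (inp s)).+1 (inp s).

Definition cond_gamma (s : state) : bool :=
  [&& olt (top (D1 s)) (top (inp s)), olt (top (inp s)) (top (I s))
    & sorted ltn (gamma_seg s)].

Definition instr1 (s : state) : bool :=
  isSome (top (I s)) && (top (I s) == next_out s).

Definition instr2 (s : state) : bool :=
  let k := size (D1 s ++ D2 s) in
  (0 < k) && perm_eq (D1 s ++ D2 s) (take k (sort leq (remaining s))).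

Definition flush (s : state) : state :=
  State (inp s) [::] [::] (I s) (out s ++ sort leq (D1 s ++ D2 s)).

Definition algo_step (s : state) : option state :=
  if instr1 s then exec_op d3 s
  else if instr2 s then Some (flush s)
  else if isSome (exec_op d1 s) && cond_beta s then exec_op d1 s
  else if isSome (exec_op d0 s) && cond_gamma s then exec_op d0 s
  else if isSome (exec_op d2 s) && cond_alpha s then exec_op d2 s
  else exec_op d3 s.

Fixpoint algo_run (fuel : nat) (s : state) : option state :=
  if final s then Some s else
  match fuel with
  | 0 => None
  | fuel'.+1 => if algo_step s is Some s' then algo_run fuel' s' else None
  end.

(* Main.v *)
Require Import Defs.
From mathcomp Require Import all_boot zify.
Set Implicit Arguments. Unset Strict Implicit. Unset Printing Implicit Defensive.

(** Every instruction preserves sortability of an arbitrary state, so no invariant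
    about the history of the algorithm is needed. Two facts drive the case
    analysis. Deleting elements from a sortable state leaves it sortable, which
    settles instructions 1 and 2. And for [m < t < x] with [t] in [I], the state is
    deadlocked as soon as [x] must precede [m] on the way to [I]: [x] cannot enter
    [I] before [t] leaves, nor [t] leave before [m], nor [m] overtake [x].
    For instructions 3-5, a solution that postpones the chosen move either can be
    reordered to make it now, or by the deadlock shows that the elements in its way
    are exactly the next ones to be output; these are then output first and the
    solution restricted to the remaining elements takes over. *)

(** * Sortable states and deletion of elements *)

Ltac perm_count :=
  apply/permP => ?; rewrite ?count_cat /= ?count_cat /= ?count_cat /=; lia.

Ltac mem_tac := rewrite ?(mem_cat, in_cons); clear;
  repeat match goal with
  | |- context [_ == _] => case: eqVneq => [->|_]
  | |- context [?x \in ?s] => case: (x \in s)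
  end; done.

(* Validity of the stacks is only required where it would otherwise be lost, hence
   [sortable_valid]. Output is emitted only in increasing order. *)
Inductive sortable : seq nat -> seq nat -> seq nat -> seq nat -> Prop :=
| SortableNil : sortable [::] [::] [::] [::]
| Sortable0 x i a b c : sortable i (x :: a) b c -> sortable (x :: i) a b c
| Sortable1 x i a b c : pairwise gtn (x :: a) ->
    sortable i a (x :: b) c -> sortable i (x :: a) b c
| Sortable2 x i a b c : pairwise gtn (x :: b) ->
    sortable i a b (x :: c) -> sortable i a (x :: b) c
| Sortable3 x i a b c : all (ltn x) (i ++ a ++ b ++ c) ->
    sortable i a b c -> sortable i a b (x :: c).

Lemma sortable_valid i a b c : sortable i a b c ->
  [/\ pairwise gtn a, pairwise gtn b & pairwise ltn c].
Proof.
elim=> {i a b c} [|x i a b c _|x i a b c xa _|x i a b c xb _|x i a b c lx _] //=.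
- by case=> /andP[_ ->] -> ->.
- by case=> _ /andP[_ ->] ->.
- by case=> -> _ /andP[_ ->].
case=> -> -> ->; rewrite andbT; split=> //.
by move: lx; rewrite !all_cat => /and4P[].
Qed.

Lemma sortable_uniq i a b c : sortable i a b c -> uniq (i ++ a ++ b ++ c).
Proof.
elim=> {i a b c} [|x i a b c _|x i a b c xa _|x i a b c xb _|x i a b c lx _] //.
- by rewrite (@perm_uniq _ _ (x :: i ++ a ++ b ++ c)) //; perm_count.
- by rewrite (@perm_uniq _ _ (i ++ x :: a ++ b ++ c)) //; perm_count.
- by rewrite (@perm_uniq _ _ (i ++ a ++ x :: b ++ c)) //; perm_count.
rewrite (@perm_uniq _ (_ ++ _ ++ _ ++ _ :: _) (x :: i ++ a ++ b ++ c))
  => [/= ->|]; last by perm_count.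
by rewrite andbT; apply/negP => /(allP lx) /=; lia.
Qed.

(** Operations on deleted elements are skipped; the conditions on the others are inherited by
    subsequences. *)
Lemma sortable_filter P i a b c : sortable i a b c ->
  sortable (filter P i) (filter P a) (filter P b) (filter P c).
Proof.
elim=> {i a b c} [|x i a b c _|x i a b c xa _|x i a b c xb _|x i a b c lx _] /=.
- exact: SortableNil.
- by case: (P x) => // /Sortable0.
- have := pairwise_filter P xa; rewrite /=; case: (P x) => // h; exact: Sortable1.
- have := pairwise_filter P xb; rewrite /=; case: (P x) => // h; exact: Sortable2.
case: (P x) => // h; apply: Sortable3 => //.
by rewrite -!filter_cat; apply/allP => z; rewrite mem_filter => /andP[_ /(allP lx)].
Qed.

(** * Deadlock *)

(** The alternatives list the places of [x] ahead of [m], and no operation leaves them: overtaking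
    in [D1] or [D2] needs [m > x], a move of [x] into [I] needs [x < t], an output of [t] needs
    [t < m]. *)
Lemma deadlock m t x i a b c : m < t < x -> t \in c ->
  [\/ x \in b /\ m \in i ++ a ++ b, x \in a /\ m \in i ++ a
    | exists i1 i2, i = i1 ++ x :: i2 /\ m \in i2] -> ~ sortable i a b c.
Proof.
move=> mtx tc dead s; elim: s tc dead => {i a b c}
  [//|z i a b c s IH|z i a b c za s IH|z i a b c zb s IH|z i a b c lz s IH] tc.
- have [/= /andP[za _] _ _] := sortable_valid s.
  case=> [[xb]|[xa]|[[|z1 i1] [i2 [/= [zx ii] mi2]]]].
  + move=> h; apply: IH => //; constructor 1; split=> //.
    by move: h; rewrite !(mem_cat, in_cons); lia.
  + rewrite inE mem_cat => /orP[/eqP mz|h].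
      by have := allP za _ xa; move: mtx => /=; lia.
    by apply: IH => //; constructor 2; rewrite !(mem_cat, in_cons) xa orbT; split=> //;
      case/orP: h => ->; rewrite ?orbT.
  + by apply: IH => //; constructor 2; rewrite zx ii mem_head mem_cat mi2.
  + by apply: IH => //; constructor 3; exists i1, i2.
- case=> [[xb]|[]|ex].
  + rewrite !(mem_cat, in_cons) => h; apply: IH => //; constructor 1.
    rewrite !(mem_cat, in_cons) xb orbT; split=> //.
    by lia.
  + rewrite in_cons => /orP[/eqP xz|xa] h.
      apply: IH => //; constructor 1; rewrite xz mem_head; split=> //.
      move: h; rewrite !(mem_cat, in_cons).
      by lia.
    move: h; rewrite mem_cat in_cons => /or3P[h|/eqP h|h].
    * by apply: IH => //; constructor 2; rewrite mem_cat h.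
    * by move: za => /= /andP[/allP/(_ _ xa)] /=; lia.
    * by apply: IH => //; constructor 2; rewrite mem_cat h orbT.
  + by apply: IH => //; constructor 3.
- have [_ _ /= /andP[zc _]] := sortable_valid s.
  have tzc : t \in z :: c by rewrite in_cons tc orbT.
  case=> [[]|h|h]; last 2 first.
  + by apply: IH => //; constructor 2.
  + by apply: IH => //; constructor 3.
  rewrite in_cons => /orP[/eqP xz|xb] h.
    by have := allP zc _ tc; rewrite /=; lia.
  apply: IH => //; constructor 1; split=> //; move: h.
  rewrite !(mem_cat, in_cons) => /or4P[->|->|/eqP mz|->]; rewrite ?orbT //.
  by move: zb => /= /andP[/allP/(_ _ xb)] /=; lia.
move=> h; move: tc; rewrite in_cons => /orP[/eqP tz|tc]; last exact: IH h.
have /(allP lz) : m \in i ++ a ++ b ++ c; last by rewrite -tz /=; lia.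
rewrite !mem_cat; case: h => [[_]|[_]|[i1 [i2 [-> mi2]]]].
- by rewrite !mem_cat => /or3P[] ->; rewrite ?orbT.
- by rewrite mem_cat => /orP[] ->; rewrite ?orbT.
- by rewrite !mem_cat in_cons mi2 !orbT.
Qed.

(** * Draining minimal elements *)

Lemma pairwise_insert x s1 s2 : pairwise gtn (s1 ++ s2) ->
  all (ltn x) s1 -> all (gtn x) s2 -> pairwise gtn (s1 ++ x :: s2).
Proof.
rewrite !pairwise_cat /= => /and3P[r12 -> ->] h1 ->; rewrite !andbT.
by rewrite allrel_consr r12 andbT.
Qed.

Lemma pairwise_remove x s1 s2 : pairwise gtn (s1 ++ x :: s2) ->
  pairwise gtn (s1 ++ s2).
Proof. by apply: subseq_pairwise; rewrite cat_subseq // subseq_cons. Qed.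

Lemma push_input i1 i a b c :
  sortable i (catrev i1 a) b c -> sortable (i1 ++ i) a b c.
Proof. by elim: i1 a => //= x i1 IH a /IH; exact: Sortable0. Qed.

(** Sending the larger of the tops of [a1] and [b] to [I] again and again merges them in decreasing
    order on top of [c1]. All these elements are then output, and the given solution takes over. *)
Lemma drain i a2 c a1 b c1 : sortable i a2 [::] c ->
  pairwise gtn (a1 ++ a2) -> pairwise gtn b -> pairwise ltn c1 ->
  uniq (a1 ++ b) -> {in a1 ++ b & c1, forall u v, u < v} ->
  {in a1 ++ b ++ c1 & i ++ a2 ++ c, forall u v, u < v} ->
  sortable i (a1 ++ a2) b (c1 ++ c).
Proof.
move=> s; have [n] := ubnP (size a1 + size b).
elim: n a1 b c1 => // n IH a1 b c1 size_n sa sb sc ab abc small.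
have move_top (u : nat) (a1' b' c1' : seq nat) : size a1' + size b' < size a1 + size b ->
    perm_eq (u :: a1' ++ b') (a1 ++ b) -> all (gtn u) (a1' ++ b') ->
    c1' = u :: c1 -> pairwise gtn (a1' ++ a2) -> pairwise gtn b' ->
    sortable i (a1' ++ a2) b' (c1' ++ c).
  move=> sz p au ec sa' sb'; subst c1'.
  have sub v : v \in a1' ++ b' -> v \in a1 ++ b by rewrite -(perm_mem p) in_cons orbC => ->.
  have ua : u \in a1 ++ b by rewrite -(perm_mem p) mem_head.
  apply: IH => //.
  - by move: size_n sz; clear; lia.
  - by rewrite /= sc andbT; apply/allP => v vc; exact: abc.
  - by move: ab; rewrite -(perm_uniq p) /= => /andP[].
  - move=> v w va; rewrite in_cons => /orP[/eqP->|wc]; first by have := allP au _ va.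
    by apply: abc => //; exact: sub.
  - move=> v w va; apply: small; move: va (sub v) ua.
    by mem_tac.
case: a1 b => [|x a1] [|y b] in size_n sa sb ab abc small move_top *.
- elim: c1 sc {abc} small {move_top} => // z c1 IHc /= /andP[zc sc] small.
  apply: Sortable3; last by apply: IHc => // u v uc; apply: small; rewrite in_cons uc orbT.
  rewrite !all_cat zc /= -!all_cat; apply/allP => v vi; apply: small; first exact: mem_head.
  by move: vi; mem_tac.
- apply: Sortable2 => //; apply: (move_top y [::] b (y :: c1)) => //.
  + by case/andP: sb.
  + by case/andP: sb.
- have xa : pairwise gtn (x :: a1) by move: sa; rewrite pairwise_cat => /and3P[].
  apply: Sortable1 => //; apply: Sortable2 => //.
  apply: (move_top x a1 [::] (x :: c1)) => //.
  + by rewrite cats0; case/andP: xa.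
  + by case/andP: sa.
have xa : pairwise gtn (x :: a1) by move: sa; rewrite pairwise_cat => /and3P[].
case: (ltngtP x y) => xy.
- apply: Sortable2 => //; apply: (move_top y (x :: a1) b (y :: c1)) => //.
  + by rewrite /= addnS.
  + by perm_count.
  + rewrite all_cat; apply/andP; split; last by case/andP: sb.
    rewrite /= xy; apply/allP => v va.
    by case/andP: xa => /allP/(_ _ va) /=; lia.
  + by case/andP: sb.
- have xb : pairwise gtn (x :: y :: b).
    apply/andP; split=> //; rewrite /= xy; apply/allP => v vb.
    by case/andP: sb => /allP/(_ _ vb) /=; lia.
  apply: Sortable1 => //; apply: Sortable2 => //.
  apply: (move_top x a1 (y :: b) (x :: c1)) => //.
  + rewrite all_cat; apply/andP; split; first by case/andP: xa.
    by case/andP: xb.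
  + by case/andP: sa.
by move: ab; rewrite xy /= mem_cat mem_head orbT.
Qed.

(** * Instruction 3 *)

(* The solution is followed with [x] already in [D2], just above the elements [b]
   that are there initially, until it moves [x] itself (the two runs then agree)
   or pops an element of [b]; in that case the deadlock makes all of [b] minimal. *)
Lemma advance_d1 x i a0 b0 c : sortable i a0 b0 c ->
  forall a1 a b1 b, a0 = a1 ++ x :: a -> b0 = b1 ++ b ->
  all (gtn x) b -> all (ltn x) (a1 ++ b1 ++ c) ->
  sortable i (a1 ++ a) (b1 ++ x :: b) c \/
  b != [::] /\ {in b & i ++ a1 ++ x :: a ++ b1 ++ c, forall u v, u < v}.
Proof.
elim=> {i a0 b0 c} [|z i a0 b0 c s IH|z i a0 b0 c za s IH|z i a0 b0 c zb s IH|z i a0 b0 c lz s IH].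
- by case.
- move=> a1 a b1 b ea eb xb xabc; subst a0 b0.
  have [za _ _] := sortable_valid s.
  have xz : x < z by move: za => /= /andP[/allP/(_ x)]; rewrite mem_cat mem_head orbT => /(_ isT).
  case: (IH (z :: a1) a b1 b) => //=; first by rewrite xz.
    by left; exact: Sortable0.
  move=> [b0 small]; right; split=> // u v ub vi; apply: small => //.
  by move: vi; mem_tac.
- move=> [|z1 a1] a b1 b /= [ez ea] eb xb xabc; subst z a0 b0.
    case: b1 => [|y b1] in s xabc {IH} *; first by left.
    have [_ /= /andP[/andP[yx _] _] _] := sortable_valid s.
    by move: xabc yx => /= /andP[]; lia.
  case: (IH a1 a (z1 :: b1) b) => //.
  + by move: xabc; rewrite /= !all_cat /= ?all_cat => /and4P[-> -> -> ->].
  + left; apply: Sortable1 => //; rewrite -cat_cons.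
    by apply: (@pairwise_remove x); rewrite cat_cons.
  move=> [b0 small]; right; split=> // u v ub vi; apply: small => //.
  by move: vi; mem_tac.
- move=> a1 a [|z1 b1] b ea /=.
    move=> eb; subst a0 b => /= /andP[zx xb] xabc; right; split=> //.
    (* Now [z] is in [I] while [x] is still in [D1]: a [v] below [z] in the input or in [D1] would
       give the deadlock with [z] as [t]. *)
    have min v : v \in i ++ a1 ++ x :: a -> z < v.
      move=> vi; rewrite ltnNge; apply/negP => vz.
      have vz' : v != z.
        have := sortable_uniq (Sortable2 zb s); rewrite catA cat_uniq.
        case/and3P=> _ /hasPn/(_ z (mem_head _ _)) zi _.
        by apply: contraTneq vi => ->.
      apply: (@deadlock v z x _ _ _ _ _ _ _ s); first by lia.
        exact: mem_head.
      by constructor 2; rewrite mem_cat mem_head orbT.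
    have [_ _ /= /andP[zc _]] := sortable_valid s.
    move=> u v uz vi; apply: (@leq_ltn_trans z).
      move: uz; rewrite in_cons => /orP[/eqP->//|ub].
      by move: zb => /= /andP[/allP/(_ _ ub)] /=; lia.
    have [|vi'] := boolP (v \in i ++ a1 ++ x :: a); first exact: min.
    apply: (allP zc); move: vi vi'; mem_tac.
  case=> ez eb xb xabc; subst z a0 b0.
  case: (IH a1 a b1 b) => //.
  + by move: xabc; rewrite !all_cat /= ?all_cat => /and4P[-> -> -> ->]; rewrite ?andbT.
  + left; apply: Sortable2 => //; rewrite -cat_cons.
    apply: pairwise_insert => //; move: xabc; rewrite -cat_cons !all_cat.
    by case/and3P.
  move=> [b0 small]; right; split=> // u v ub vi; apply: small => //.
  by move: vi; mem_tac.
move=> a1 a b1 b ea eb xb; subst a0 b0.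
rewrite !all_cat /= => /and4P[_ _ xz _].
exfalso; have /(allP lz) : x \in i ++ (a1 ++ x :: a) ++ (b1 ++ b) ++ c.
  by rewrite !mem_cat mem_head !orbT.
by move: xz => /=; lia.
Qed.

(* Until [x] has left [D2] nothing can be output, so the smaller elements put back
   under [x] are in nobody's way. *)
Lemma reinsert_min x i a b0 c : sortable i a b0 c ->
  forall b1 b, b0 = b1 ++ [:: x] -> pairwise gtn (x :: b) ->
  all (ltn x) (b1 ++ c) ->
  {in b & i ++ a ++ b1 ++ x :: c, forall u v, u < v} ->
  sortable i a (b1 ++ x :: b) c.
Proof.
elim=> {i a b0 c} [|z i a b0 c s IH|z i a b0 c za s IH|z i a b0 c zb s IH|z i a b0 c lz s IH].
- by case.
- move=> b1 b eb xb xbc small; subst b0.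
  apply: Sortable0; apply: IH => // u v ub vi; apply: small => //.
  by move: vi; mem_tac.
- move=> b1 b eb xb xbc small; subst b0.
  have [_ /= /andP[zb _] _] := sortable_valid s.
  have xz : x < z by have := allP zb x; rewrite mem_cat mem_head orbT => /(_ isT).
  apply: Sortable1 => //; apply: (IH (z :: b1)) => //=; first by rewrite xz.
  by move=> u v ub vi; apply: small => //; move: vi; mem_tac.
- move=> [|z1 b1] b /= [ez eb] xb xbc small; subst z b0.
    (* The move of [x] to [I] uncovers [b], which is minimal and is output at once; then the old
       solution continues. *)
    apply: Sortable2 => //; apply: (@drain _ a (x :: c) [::] b [::]) => //.
    + by have [] := sortable_valid s.
    + by case/andP: xb.
    + by case/andP: xb => _ /(pairwise_uniq ltnn).
    + by move=> u v; rewrite cats0 => ub vi; apply: small.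
  have zz : pairwise gtn (z1 :: b1 ++ x :: b).
    rewrite (_ : z1 :: _ = (z1 :: b1 ++ [:: x]) ++ b); last by rewrite /= -catA.
    rewrite pairwise_cat zb; case/andP: (xb) => xb' ->; rewrite !andbT; apply/allrelP => u v.
    rewrite -cat_cons mem_cat mem_seq1 => h vb; have := allP xb' _ vb.
    case/orP: h => [|/eqP->//].
    by move: xbc; rewrite all_cat andbA => /andP[/(@allP _ _ (z1 :: b1)) h _] /h /=; lia.
  apply: Sortable2 => //; apply: IH => //.
    by move: xbc; rewrite /= !all_cat /= andbCA.
  by move=> u v ub vi; apply: small => //; move: vi; mem_tac.
move=> b1 b eb xb; subst b0; rewrite all_cat /= => /and3P[_ xz _].
exfalso; have /(allP lz) : x \in i ++ a ++ (b1 ++ [:: x]) ++ c.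
  by rewrite !mem_cat mem_head !orbT.
by move: xz => /=; lia.
Qed.

(** In the second alternative of [advance_d1], [b] is minimal. It is deleted from the solution,
    [advance_d1] is applied again with nothing under [x], which excludes that alternative, and
    [reinsert_min] puts [b] back. *)
Lemma sortable_d1 x i a b c : sortable i (x :: a) b c ->
  all (gtn x) b -> all (ltn x) c -> sortable i a (x :: b) c.
Proof.
move=> s xb xc.
case: (@advance_d1 x _ _ _ _ s [::] a [::] b) => // -[_ small].
have keep r : {subset r <= i ++ x :: a ++ c} -> filter [pred u | u \notin b] r = r.
  move=> ri; apply/all_filterP/allP => u /ri ui /=; apply/negP => ub.
  by have := small _ _ ub ui; rewrite ltnn.
have := sortable_filter [pred u | u \notin b] s.
have -> : filter [pred u | u \notin b] b = [::].
  by apply/eqP; rewrite -(negbK (_ == _)) -has_filter; apply/hasPn => u ub /=; rewrite ub.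
rewrite !keep; first last.
- by move=> u; mem_tac.
- by move=> u; mem_tac.
- by move=> u; mem_tac.
move=> s'; case: (@advance_d1 x _ _ _ _ s' [::] a [::] [::]) => //= [s2|[]//].
apply: (@reinsert_min x _ _ _ _ s2 [::]) => //.
  by have [_ sb _] := sortable_valid s; rewrite /= xb.
by move=> u v ub vi; apply: small => //; move: vi; mem_tac.
Qed.

(** * Instructions 4 and 5 *)

Definition gamma_prefix b (i : seq nat) := take (find (fun x => olt (top b) (Some x)) i).+1 i.

(** Legality and (β) in one test, against whole stacks instead of their tops; on valid stacks this
    is equivalent by [olt_top_gtn] and [olt_top_ltn]. Likewise [d0_applies] for (γ). *)
Definition d1_applies a b c :=
  if a is x :: _ then all (gtn x) b && all (ltn x) c else false.

Definition d0_applies i a b c :=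
  if i is u :: _ then [&& all (gtn u) a, all (ltn u) c & sorted ltn (gamma_prefix b i)]
  else false.

(* While [y] stays in [D2], the failure of (beta) and (gamma) survives every [d0],
   and a [d1] would deadlock; hence [d2] can be anticipated. *)
Lemma sortable_d2 y i a b0 b c : sortable i a b0 c -> b0 = y :: b ->
  all (ltn y) c -> ~~ d1_applies a b0 c -> ~~ d0_applies i a b0 c ->
  sortable i a b (y :: c).
Proof.
move=> s; elim: s b => {i a b0 c}
  [//|z i a b0 c s IH|z i a b0 c za s IH|z i a b0 c zb s IH|z i a b0 c lz s IH] b eb yc.
- have [/= /andP[za sa] sb _] := sortable_valid s.
  subst b0; rewrite /= za /= => _ ngam.
  apply: Sortable0; apply: IH => //.
    (* If pushing [z] enabled [d1], then [y < z] and [z] is below all of [I]; the segment of (γ) was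
       just [z], so [d0] applied before. *)
    apply: contra ngam => /= /andP[/andP[yz _] ->] /=.
    by rewrite /gamma_prefix /= yz take0.
  (* If [u] could be pushed next, then [z < u]: the segment from [z] is [z] alone or [z] before the
     increasing segment from [u], so [d0] applied before. *)
  apply: contra ngam; case: i {s} => //= u i /and3P[/andP[zu ua] uc].
  have -> : all (ltn z) c by apply: sub_all uc => v /=; lia.
  rewrite /gamma_prefix /=; case: ifP => yu; case: ifP => //= yz; rewrite ?take0 //=.
    by move=> _; rewrite zu.
  by move=> ->; rewrite zu.
- subst b0 => /= nb _.
  have [_ sb _] := sortable_valid s.
  have {}nb : ~~ all (ltn z) c.
    by apply: contra nb => ->; rewrite andbT; case/andP: sb.
  case/allPn: nb => t tc zt.
  have ct : z != t.
    have := sortable_uniq s; rewrite !catA cat_uniq => /and3P[_ /hasPn/(_ _ tc) h _].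
    by apply: contraNneq h => <-; rewrite !(mem_cat, in_cons) eqxx !orbT.
  exfalso; apply: (@deadlock y t z _ _ _ _ _ tc _ s).
    have := allP yc _ tc; move: zt ct => /=; lia.
  by constructor 1; rewrite !(mem_cat, in_cons) !eqxx !orbT.
- by case: eb => <- <-.
subst b0; move: yc => /= /andP[yz _].
exfalso; have /(allP lz) : y \in i ++ a ++ (y :: b) ++ c.
  by rewrite !(mem_cat, in_cons) eqxx !orbT.
by move: yz => /=; lia.
Qed.

Lemma uniq_cat_neq (T : eqType) (s1 s2 : seq T) x y :
  uniq (s1 ++ s2) -> x \in s1 -> y \in s2 -> x != y.
Proof.
by rewrite cat_uniq => /and3P[_ /hasPn h _] xs /h /=; apply: contraNneq => <-.
Qed.

(** Isolates the part of the segment of (γ) that must be output no later than [y]; [take 1] allows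
    for an input without larger elements. *)
Lemma gamma_prefix_split y b l : exists pre post,
  [/\ l = pre ++ post, gamma_prefix (y :: b) l = pre ++ take 1 post,
      all (geq y) pre & if post is v :: _ then y < v else true].
Proof.
elim: l => [|x l [pre [post [-> eseg le_pre post_gt]]]]; first by exists [::], [::].
rewrite /gamma_prefix /=; case: ltnP => [yx|xy].
  by exists [::], (x :: pre ++ post); rewrite /= take0.
exists (x :: pre), post; split=> //=; last by rewrite xy.
by rewrite -eseg.
Qed.

Lemma catrev_pairwise u p a : path ltn u p -> pairwise gtn (u :: a) ->
  pairwise gtn (catrev p (u :: a)).
Proof.
elim: p u a => //= v p IH u a /andP[uv vp] /andP[ua sa].
apply: IH => //=; rewrite uv ua sa !andbT.
by apply: sub_all ua => z /=; lia.
Qed.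

(** The first move of the solution decides. A [d0] is the wanted move; a [d1] would make instruction
    3 applicable, as [Top(D1) < u] and [u] is below all of [I]; a [d3] would output an element
    larger than [u]. The case of [d2] remains. *)
Lemma sortable_d0 u i a b c : sortable (u :: i) a b c ->
  ~~ d1_applies a b c -> d0_applies (u :: i) a b c ->
  sortable i (u :: a) b c \/
  a ++ b != [::] /\ {in a ++ b & (u :: i) ++ c, forall x y, x < y}.
Proof.
move=> s nb /and3P[ua uc sseg].
inversion s as [|? ? ? ? ? s1|x ? a' ? ? xa s1|y ? ? b' ? yb s1|z ? ? ? ? lz s1]; subst.
- by left.
- have [_ /= /andP[xb _] _] := sortable_valid s1.
  case/andP: ua => xu _; case/negP: nb; rewrite /= xb /=.
  by apply: sub_all uc => z /=; move: xu => /=; lia.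
- have [sa sb sc] := sortable_valid s.
  have [_ _ /= /andP[yc _]] := sortable_valid s1.
  have un := sortable_uniq s.
  (* [Top(D1)] is below [u], hence below all of [I], so instruction 3 can only fail at [D2], which
     forces [Top(D1) < y]. *)
  have ay : all (gtn y) a.
    case: a => [//|x a] in s s1 un sa ua nb *.
    have xc : all (ltn x) c.
      by case/andP: ua => xu _; apply: sub_all uc => z; move: xu => /=; lia.
    move: nb; rewrite /= xc andbT negb_and => nb.
    have xy : x != y.
      apply: (@uniq_cat_neq _ (u :: i ++ x :: a) ((y :: b') ++ c)).
      - by move: un; rewrite /= -!catA.
      - by rewrite in_cons mem_cat mem_head !orbT.
      - exact: mem_head.
    have {}xy : x < y.
      rewrite ltn_neqAle xy leqNgt; apply: contraL nb => yx; rewrite yx /=.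
      by rewrite negbK; case/andP: yb => /sub_all-> // z /=; lia.
    rewrite /= xy; case/andP: sa => /sub_all-> // z /=; lia.
  (* If the first move is [d2] on [y], then the deadlock puts everything smaller than
     [y] in [D1], [D2] or the input prefix [pre]. *)
  have [pre [post [e eseg le_pre post_gt]]] := gamma_prefix_split y b' (u :: i).
  have post_y : {in post, forall m, y < m}.
    case: post => [//|v post] in e eseg post_gt * => m.
    rewrite in_cons => /orP[/eqP->//|mpost]; rewrite ltnNge; apply/negP => my.
    apply: (@deadlock m y v _ _ _ _ _ _ _ s1); last 1 first.
    + by constructor 3; exists pre, post.
    + rewrite post_gt andbT ltn_neqAle my andbT.
      apply: (@uniq_cat_neq _ (u :: i) (a ++ (y :: b') ++ c)) => //.
      - by rewrite e mem_cat in_cons mpost !orbT.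
      - by rewrite !mem_cat mem_head !orbT.
    + exact: mem_head.
  have big m : m \in post ++ c -> y < m.
    by rewrite mem_cat => /orP[/post_y //|/(allP yc)].
  case: pre => [|u' pre] in e eseg le_pre *.
    (* Here [u > y], so [D1] and [D2] hold exactly the elements up to [y]. *)
    right; split; first by case: (a).
    rewrite -cat_cons e /= => p q pa /big; apply: leq_trans; move: pa; rewrite mem_cat in_cons.
    case/or3P=> [/(allP ay)|/eqP->//|]; first by rewrite /= => ?; apply: ltnW.
    by case/andP: yb => /allP h _ /h /= /ltnW.
  (* By (γ), [u :: pre] is increasing and can be pushed into [D1] as a whole. Then [D1] and [D2]
     hold exactly the elements up to [y]; [drain] outputs them, and the solution restricted to the
     larger elements finishes. *)
  case: e => eu ei; subst u' i; left; apply: push_input.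
  rewrite -(cats0 (catrev _ _)) -(cat0s c).
  rewrite eseg /= cat_path in sseg; case/andP: sseg => sseg _.
  have low m : m \in (u :: pre) ++ a ++ y :: b' -> m <= y.
    rewrite !mem_cat => /or3P[/(allP le_pre)//|/(allP ay) /ltnW//|].
    by rewrite in_cons => /orP[/eqP->//|]; case/andP: yb => /allP h _ /h /ltnW.
  apply: drain => //.
  + have keep r : {in r, forall m, y < m} -> filter (ltn y) r = r.
      by move=> h; apply/all_filterP/allP.
    have none r : {in r, forall m, m <= y} -> filter (ltn y) r = [::].
      move=> h; apply/eqP; rewrite -(negbK (_ == _)) -has_filter.
      by apply/hasPn => m /h /=; rewrite -leqNgt.
    have := sortable_filter (ltn y) s.
    rewrite -cat_cons filter_cat (none (u :: pre)) ?(none a) ?(none (y :: b')) ?keep //.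
    * exact/allP.
    * by move=> m h; apply: low; rewrite !mem_cat h !orbT.
    * by move=> m h; apply: low; rewrite !mem_cat h !orbT.
    * by move=> m h; apply: low; rewrite mem_cat h.
  + by rewrite cats0; apply: catrev_pairwise; rewrite //= ua.
  + have p : perm_eq ((u :: pre ++ post) ++ a ++ (y :: b') ++ c)
        ((catrev pre (u :: a) ++ y :: b') ++ post ++ c).
      by apply/permP => P; rewrite catrevE !(count_cat, count_rev) /= !count_cat /=; lia.
    by move: un; rewrite (perm_uniq p) cat_uniq => /andP[].
  + move=> p q pa qc; apply: (@leq_ltn_trans y); last exact: big.
    apply: low; move: pa; rewrite catrevE cats0 !(mem_cat, mem_rev, in_cons).
    by clear; lia.
- exfalso; have /(allP lz) : u \in u :: i ++ a ++ b ++ c0 by rewrite mem_head.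
  by case/andP: uc => /=; lia.
Qed.

(** * Progress *)

(** Hence instruction 6 is never reached from a sortable state that is not final. If [t] tops [I]
    and instruction 1 fails, some [m < t] is still outside [I]. The front element of the first
    nonempty one among [D2], [D1] and the input either fits below [t], so that its instruction
    applies, or exceeds [t] and deadlocks with [m]. *)
Lemma progress i a b c : sortable i a b c -> i ++ a ++ b ++ c != [::] ->
  (if c is t :: _ then ~~ all (ltn t) (i ++ a ++ b) else true) ->
  ~~ d1_applies a b c -> ~~ d0_applies i a b c ->
  exists y b', b = y :: b' /\ all (ltn y) c.
Proof.
move=> s ne nmin nbeta ngamma; have [sa sb sc] := sortable_valid s.
case: c => [|t c] in s ne nmin nbeta ngamma sc *.
  case: b => [|y b] in s ne nbeta ngamma sb *; last by exists y, b.
  case: a => [|x a] in s ne nbeta ngamma sa *; last by case/negP: nbeta.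
  by case: i => [|u i] // in s ne ngamma *; case/negP: ngamma; rewrite /= /gamma_prefix /= take0.
case/allPn: nmin => m mi mt.
have un := sortable_uniq s.
have {}mt : m < t.
  rewrite ltn_neqAle [m <= t]leqNgt mt andbT; apply: (@uniq_cat_neq _ (i ++ a ++ b) (t :: c)) => //.
    by rewrite -!catA.
  exact: mem_head.
have gt_top x : x \in i ++ a ++ b -> ~~ all (ltn x) (t :: c) -> t < x.
  move=> xi h; rewrite ltn_neqAle eq_sym; apply/andP; split.
    apply: (@uniq_cat_neq _ (i ++ a ++ b) (t :: c)) => //; last exact: mem_head.
    by rewrite -!catA.
  rewrite leqNgt; apply: contra h => xt; rewrite /= xt.
  by case/andP: sc => /sub_all-> // z; move: xt => /=; lia.
have dead := fun x h => @deadlock m t x i a b (t :: c) h (mem_head _ _).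
case: b => [|y b] in s ne nbeta ngamma mi un gt_top dead sb *; last first.
  exists y, b; split=> //; apply/negPn/negP => h; apply: (dead y _ _ s).
    by rewrite mt gt_top // !(mem_cat, in_cons) eqxx !orbT.
  by constructor 1; rewrite mem_head.
exfalso; rewrite cats0 in mi gt_top.
case: a => [|x a] in s ne nbeta ngamma mi un gt_top dead sa *; last first.
  apply: (dead x _ _ s); last by constructor 2; rewrite mem_head.
  by rewrite mt gt_top // mem_cat mem_head orbT.
rewrite cats0 in mi gt_top.
case: i => [//|u i] in s ne ngamma mi un gt_top dead *.
(* With [D1] and [D2] empty, the segment of (γ) is [u] alone, so only the comparison of [u] with [I]
   can fail. *)
have tu : t < u.
  apply: gt_top; first exact: mem_head.
  by apply: contra ngamma => /= ->; rewrite /gamma_prefix /= take0.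
apply: (dead u _ _ s); first by rewrite mt.
constructor 3; exists [::], i; split=> //.
by move: mi; rewrite in_cons => /orP[/eqP|//]; lia.
Qed.

(** * The machine and the run of the algorithm *)

Definition sortable_state s := sortable (inp s) (D1 s) (D2 s) (I s).

(** An invariant of the algorithm that becomes the output in a final state. *)
Definition full_output s := out s ++ sort leq (remaining s).

(** Counts the operations still ahead of each element; every step lowers it. *)
Definition potential s :=
  4 * size (inp s) + 3 * size (D1 s) + 2 * size (D2 s) + size (I s).

Lemma olt_top_gtn a x : pairwise gtn a -> olt (top a) (Some x) = all (gtn x) a.
Proof.
case: a => //= y a /andP[ya _]; case: ltnP => //= yx.
by symmetry; apply: sub_all ya => z /=; lia.
Qed.

Lemma olt_top_ltn c x : pairwise ltn c -> olt (Some x) (top c) = all (ltn x) c.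
Proof.
case: c => //= y c /andP[yc _]; case: ltnP => //= xy.
by symmetry; apply: sub_all yc => z /=; lia.
Qed.

Lemma sort_cat (s1 s2 : seq nat) : allrel leq s1 s2 ->
  sort leq (s1 ++ s2) = sort leq s1 ++ sort leq s2.
Proof.
move=> le12; apply: (sorted_eq leq_trans anti_leq).
- exact: (sort_sorted leq_total).
- rewrite sorted_pairwise; last exact: leq_trans.
  rewrite pairwise_cat -!sorted_pairwise; try exact: leq_trans.
  rewrite !(sort_sorted leq_total) !andbT; apply/allrelP => x y.
  by rewrite !mem_sort; exact: (allrelP le12).
by rewrite perm_sort perm_cat // perm_sym perm_sort.
Qed.

Lemma perm_sort_leq (s1 s2 : seq nat) : perm_eq s1 s2 -> sort leq s1 = sort leq s2.
Proof. by move=> ?; apply/(perm_sortP leq_total leq_trans anti_leq). Qed.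

Lemma sortable_pop t i a b c : sortable i a b (t :: c) -> sortable i a b c.
Proof.
move=> s; have [_ _ /= /andP[tc _]] := sortable_valid s.
have un := sortable_uniq s.
have keep r : {subset r <= i ++ a ++ b} -> filter [pred x | x != t] r = r.
  move=> ri; apply/all_filterP/allP => x /ri xi.
  by apply: (uniq_cat_neq _ xi (mem_head t c)); rewrite -!catA.
have := sortable_filter [pred x | x != t] s; rewrite /= eqxx /=.
rewrite (keep i) ?(keep a) ?(keep b); try by move=> x; rewrite !mem_cat => ->; rewrite ?orbT.
by rewrite (_ : filter _ c = c) //; apply/all_filterP/allP => x /(allP tc) /=; lia.
Qed.

Lemma sortable_flush i a b c : sortable i a b c -> sortable i [::] [::] c.
Proof.
move=> s; have un := sortable_uniq s.
have drop r : {subset r <= a ++ b} -> filter [pred x | x \notin a ++ b] r = [::].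
  move=> ri; apply/eqP; rewrite -(negbK (_ == _)) -has_filter.
  by apply/hasPn => x /ri /= ->.
have keep r : {subset r <= i ++ c} -> filter [pred x | x \notin a ++ b] r = r.
  move=> ri; apply/all_filterP/allP => x /ri xi /=; apply/negP => xab.
  have : uniq ((i ++ c) ++ (a ++ b)) by rewrite (perm_uniq (s2 := i ++ a ++ b ++ c)) //; perm_count.
  by move/uniq_cat_neq => /(_ _ _ xi xab); rewrite eqxx.
have := sortable_filter [pred x | x \notin a ++ b] s.
rewrite (drop a) ?(drop b) ?(keep i) ?(keep c) //;
  by move=> x; rewrite mem_cat => ->; rewrite ?orbT.
Qed.

Lemma sort_remaining_flush i a b c : allrel leq (a ++ b) (i ++ c) ->
  sort leq (i ++ a ++ b ++ c) = sort leq (a ++ b) ++ sort leq (i ++ c).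
Proof. by move/sort_cat <-; apply: perm_sort_leq; perm_count. Qed.

(** What is output from [s] on is a permutation of [remaining s], so an increasing output puts each
    popped element below all that remain, as [Sortable3] demands. *)
Lemma exec_sortable os s s' : exec_ops os s = Some s' -> final s' ->
  sorted ltn (out s') -> pairwise gtn (D1 s) -> pairwise gtn (D2 s) ->
  sortable_state s /\ exists2 w, out s' = out s ++ w & perm_eq w (remaining s).
Proof.
elim: os s => [|o os IH] [i a b c w] /=.
  case=> <- /and4P[/= /nilP-> /nilP-> /nilP-> /nilP->] _ _ _.
  by split; [exact: SortableNil | exists [::]; rewrite // cats0].
case: o.
- case: i => [//|x i]; case: ifP => // ax e fin so sa sb.
  rewrite olt_top_gtn // in ax.
  case: (IH _ e) => //=; first by rewrite ax.
  move=> s [w' ew pw]; split; first exact: Sortable0.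
  by exists w' => //; apply: perm_trans pw _; rewrite /remaining /=; perm_count.
- case: a => [//|x a]; case: ifP => // bx e fin so sa sb.
  rewrite olt_top_gtn // in bx.
  case: (IH _ e) => //=; [by case/andP: sa|by rewrite bx|].
  move=> s [w' ew pw]; split; first exact: Sortable1.
  by exists w' => //; apply: perm_trans pw _; rewrite /remaining /=; perm_count.
- case: b => [//|x b]; case: ifP => // _ e fin so sa sb.
  case: (IH _ e) => //=; first by case/andP: sb.
  move=> s [w' ew pw]; split; first exact: Sortable2.
  by exists w' => //; apply: perm_trans pw _; rewrite /remaining /=; perm_count.
case: c => [//|x c] e fin so sa sb.
case: (IH _ e) => //= s [w' ew pw]; split; last first.
  exists (x :: w'); first by rewrite ew cat_rcons.
  rewrite perm_sym -(perm_cons x) in pw; rewrite perm_sym; apply: perm_trans pw.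
  by rewrite /remaining /=; perm_count.
apply: Sortable3 => //; move: so; rewrite ew cat_rcons /=.
rewrite sorted_pairwise; last exact: ltn_trans.
rewrite pairwise_cat /= => /and3P[_ _ /andP[xw _]].
by rewrite -(eq_all_r (perm_mem pw)).
Qed.

Lemma algo_step_sortable s : sortable_state s -> ~~ final s ->
  exists s', [/\ algo_step s = Some s', sortable_state s', full_output s' = full_output s
    & potential s' < potential s].
Proof.
case: s => i a b c w; rewrite /sortable_state /= => s nfin.
have [sa sb sc] := sortable_valid s.
rewrite /algo_step; case: ifP => [|not1].
  rewrite /instr1 /next_out /=; case: c => [//|t c] /= in s sc {nfin} *.
  case er: (sort _ _) => [//|t' r] /= /eqP[et]; subst t'.
  exists (State i a b c (rcons w t)); split=> //.
  - exact: sortable_pop s.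
  - rewrite /full_output cat_rcons /=; congr cat; rewrite er; congr cons.
    apply: (sorted_eq leq_trans anti_leq).
    + exact: (sort_sorted leq_total).
    + have := sort_sorted leq_total (i ++ a ++ b ++ t :: c).
      by rewrite -[_ ++ _]/(remaining (State i a b (t :: c) w)) er => /path_sorted.
    rewrite perm_sort -(perm_cons t) -er perm_sym perm_sort /remaining /=.
    by perm_count.
  - by rewrite /potential /=; lia.
case: ifP => [|not2].
  rewrite /instr2 /= => /andP[k0 p]; eexists; split; first by [].
  - exact: sortable_flush s.
  - rewrite /full_output /flush /= -catA; congr cat; rewrite /remaining /=.
    rewrite -sort_remaining_flush //; set r := sort _ _ in p.
    have p' : perm_eq (i ++ c) (drop (size (a ++ b)) r).
      rewrite -(perm_cat2l (a ++ b)); apply: (@perm_trans _ r).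
        by rewrite perm_sym perm_sort /remaining /=; perm_count.
      by rewrite -{1}(cat_take_drop (size (a ++ b)) r) perm_cat2r perm_sym.
    have : sorted leq r by exact: (sort_sorted leq_total).
    rewrite sorted_pairwise; last exact: leq_trans.
    rewrite -(cat_take_drop (size (a ++ b)) r) pairwise_cat => /andP[/allrelP le _].
    by apply/allrelP => x y; rewrite (perm_mem p) (perm_mem p'); exact: le.
  - by move: k0; rewrite /potential /= size_cat; lia.
have -> : isSome (exec_op d1 (State i a b c w)) && cond_beta (State i a b c w)
    = d1_applies a b c.
  case: a sa {s nfin not1 not2} => //= x a _; rewrite /cond_beta /= olt_top_gtn //.
  by case: (all _ b) => //=; rewrite -olt_top_ltn.
case: ifP => [|nbeta].
  case: a => [//|x a] in s sa {nfin not1 not2} * => /andP[xb xc].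
  rewrite /= olt_top_gtn // xb; eexists; split; first by [].
  - exact: sortable_d1.
  - by rewrite /full_output /remaining /=; congr cat; apply: perm_sort_leq; perm_count.
  - by rewrite /potential /=; lia.
have -> : isSome (exec_op d0 (State i a b c w)) && cond_gamma (State i a b c w)
    = d0_applies i a b c.
  case: i {s nfin not1 not2} => //= x i; rewrite /cond_gamma /= olt_top_gtn //.
  by case: (all _ a) => //=; rewrite -olt_top_ltn.
case: ifP => [|ngamma].
  case: i => [//|x i] in s {nfin not1} not2 * => /[dup] gam /andP[ax _].
  rewrite /= olt_top_gtn // ax; eexists; split; first by [].
  (* The other alternative of [sortable_d0] is the condition of instruction 2, which has failed. *)
  - case: (sortable_d0 s (negbT nbeta) gam) => // -[ne small]; case/negP: not2.
    rewrite /instr2 /remaining /= lt0n size_eq0 ne -[x :: i ++ _]/((x :: i) ++ a ++ b ++ c).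
    rewrite sort_remaining_flush.
      rewrite take_size_cat ?size_sort //. by rewrite andTb perm_sym perm_sort.
    by apply/allrelP => y z ya zi; apply: ltnW; apply: small => //; move: zi; mem_tac.
  - by rewrite /full_output /remaining /=; congr cat; apply: perm_sort_leq; perm_count.
  - by rewrite /potential /=; lia.
case: (@progress _ _ _ _ s) => //; rewrite ?nbeta ?ngamma //.
- by apply: contra nfin; rewrite -size_eq0 !size_cat !addn_eq0.
- case: c => [//|t c] in s not1 {nfin not2} sc nbeta ngamma *; apply: contraFN not1 => tmin.
  rewrite /instr1 /next_out (_ : sort _ _ = sort leq ([:: t] ++ i ++ a ++ b ++ c)); last first.
    by apply: perm_sort_leq; rewrite /remaining /=; perm_count.
  rewrite sort_cat //= allrel1l; apply/allP => z; rewrite !catA mem_cat -!catA.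
  by case/orP=> [/(allP tmin)|]; [|case/andP: sc => /allP h _ /h] => /ltnW.
move=> y [b' [eb yc]]; subst b.
have yt : olt (Some y) (top c) by rewrite olt_top_ltn.
rewrite /= in yt; rewrite /cond_alpha /= !yt /=; eexists; split; first by [].
- by apply: (sortable_d2 s) => //; rewrite ?nbeta ?ngamma.
- by rewrite /full_output /remaining /=; congr cat; apply: perm_sort_leq; perm_count.
- by rewrite /potential /=; lia.
Qed.

Theorem mainTheorem11 (n : nat) (p : seq nat) :
  perm_eq p (iota 1 n) -> two_sortable p ->
  exists fuel s, algo_run fuel (init p) = Some s /\ sorted ltn (out s).
Proof.
move=> _ [os [s [e [fin so]]]].
have [s0 _] := exec_sortable e fin so isT isT.
have tot : sorted ltn (full_output (init p)).
  rewrite /full_output /= /remaining /= !cats0 ltn_sorted_uniq_leq sort_uniq.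
  by rewrite (sort_sorted leq_total) andbT; have := sortable_uniq s0; rewrite !cats0.
(* Induction on a bound for the potential, over all sortable states with increasing [full_output];
   each step costs one unit of fuel. *)
elim: {e}_.+1 {-2}(init p) (ltnSn (potential (init p))) s0 tot => // k IH q.
rewrite ltnS => lek sq tot.
have [finq|nfinq] := boolP (final q).
  exists 0, q; rewrite /= finq; split=> //; move: tot.
  case/and4P: finq; rewrite /full_output /remaining.
  by move=> /nilP-> /nilP-> /nilP-> /nilP->; rewrite /= cats0.
have [q' [eq' sq' tq' lt]] := algo_step_sortable sq nfinq.
have [||fuel [r [er sr]]] := IH q' _ sq'.
- exact: leq_trans lek.
- by rewrite tq'.
by exists fuel.+1, r; rewrite /= (negbTE nfinq) eq'.
Qed.
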